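(* For all integers $n\ge 0$, the number $p(n)$ of integer partitions of $n$ is equal to the number $gs(n)$ of receding stacks with summits of size $n$: $$gs(n)=p(n).$$
   Context: A receding stack with summit of size $n\ge 1$ is a finite sequence of positive integers summing to $n$, written as $a_1,\dots,a_r,c,b_s,b_{s-1},\dots,b_1$ with $r,s\ge 0$, in which one occurrence $c$ of the largest part is marked as the summit, such that $1\le a_1\le a_2\le\dots\le a_r\le c$ and $c\ge b_s\ge b_{s-1}\ge\dots\ge b_1\ge 1$, and such that every integer from $1$ to $c-1$ occurs at least once among $a_1,\dots,a_r$ and at least once among $b_1,\dots,b_s$. Sequences with different marked occurrences of the largest part are counted as distinct. For example, with the summit overlined, the receding stacks with summits of size $4$ are $1\overline{2}1$, $\overline{1}111$, $1\overline{1}11$, $11\overline{1}1$, $111\overline{1}$, so $gs(4)=5$. By convention $gs(0)=1$ (the empty stack), and $p(0)=1$. *)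

(* Defs.v *)
From mathcomp Require Import all_boot.

Set Implicit Arguments.
Unset Strict Implicit.
Unset Printing Implicit Defensive.

(* Partitions are written with their parts in nonincreasing order. *)
Definition is_partition (n : nat) (s : seq nat) : bool :=
  [&& 0 \notin s, sorted geq s & sumn s == n].

(* The stack a_1, ..., a_r, c, b_s, ..., b_1 with marked part c is given by
   a = [:: a_1; ...; a_r], c and b = [:: b_s; ...; b_1] (in reading order), so
   that different marked positions give different triples; the two monotonicity
   conditions make c a largest part. *)
Definition is_receding_stack (n : nat) (a : seq nat) (c : nat) (b : seq nat) :
  bool :=
  [&& 0 \notin a ++ c :: b,
      sumn (a ++ c :: b) == n,
      sorted leq (rcons a c),
      sorted geq (c :: b),
      all (fun k => k \in a) (iota 1 c.-1) &
      all (fun k => k \in b) (iota 1 c.-1)].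

(* For counting purposes, sequences of positive integers with sum at most n are
   identified with sequences of length at most n over {0, ..., n}; the lemmas
   below show that these bounds exclude nothing. *)
Definition bounded_seq (n : nat) : finType := n.-bseq 'I_n.+1.

Definition parts (n : nat) (s : bounded_seq n) : seq nat :=
  [seq val i | i <- val s].

Definition num_partitions (n : nat) : nat :=
  #|[set s : bounded_seq n | is_partition n (parts s)]|.

(* No triple (a, c, b) has size 0: the value at 0 is a convention. *)
Definition num_receding_stacks (n : nat) : nat :=
  if n == 0 then 1 else
  #|[set x : bounded_seq n * 'I_n.+1 * bounded_seq n |
      is_receding_stack n (parts x.1.1) x.1.2 (parts x.2)]|.

Lemma parts_inj (n : nat) : injective (@parts n).
Proof. by move=> s t /(inj_map val_inj) /val_inj. Qed.

Lemma parts_onto (n : nat) (s : seq nat) :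
  0 \notin s -> sumn s <= n -> exists t : bounded_seq n, parts t = s.
Proof.
move=> s0 sn.
have sz : size s <= n.
  apply: leq_trans sn.
  elim: s s0 => //= x s IHs; rewrite inE negb_or eq_sym -lt0n => /andP[x0 s0].
  by rewrite -add1n leq_add // IHs.
have le_n : all (fun x => x <= n) s.
  apply/allP => x xs; apply: leq_trans sn.
  elim: s xs {s0 sz} => //= y s IHs; rewrite inE => /orP[/eqP<-|/IHs xs].
    by rewrite leq_addr.
  by rewrite (leq_trans xs) ?leq_addl.
have szm : size [seq @inord n x | x <- s] <= n by rewrite size_map.
exists (Bseq szm); rewrite /parts /= -map_comp -[RHS]map_id.
by apply/eq_in_map => x xs /=; rewrite inordK // ltnS (allP le_n).
Qed.

Lemma partition_bounded (n : nat) (s : seq nat) :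
  is_partition n s -> exists t : bounded_seq n, parts t = s.
Proof. by case/and3P => s0 _ /eqP sn; apply: parts_onto; rewrite ?sn. Qed.

Lemma receding_stack_bounded (n : nat) (a : seq nat) (c : nat) (b : seq nat) :
  is_receding_stack n a c b ->
  exists x : bounded_seq n * 'I_n.+1 * bounded_seq n,
    [/\ parts x.1.1 = a, val x.1.2 = c & parts x.2 = b].
Proof.
rewrite /is_receding_stack mem_cat inE !negb_or sumn_cat /=.
case/and3P => /and3P[a0 _ b0] /eqP sn _.
have [t ta] : exists t : bounded_seq n, parts t = a.
  by apply: parts_onto; rewrite // -sn leq_addr.
have [u ub] : exists u : bounded_seq n, parts u = b.
  by apply: parts_onto; rewrite // -sn addnA leq_addl.
have cn : c < n.+1 by rewrite ltnS -sn addnCA leq_addr.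
by exists (t, Ordinal cn, u).
Qed.

Lemma receding_stack_pos (a : seq nat) (c : nat) (b : seq nat) :
  ~~ is_receding_stack 0 a c b.
Proof.
rewrite /is_receding_stack mem_cat inE !negb_or sumn_cat /=.
apply/negP => /and3P[/and3P[_ c0 _] + _].
by rewrite !addn_eq0 => /and3P[_ /eqP cz _]; rewrite cz in c0.
Qed.

(* Main.v *)
(** Both families are counted by [\sum_c q^(c^2) / ((q)_c (q)_c)], read
    bijectively through the Durfee square.  A stack [(a, c, b)] corresponds to
    the partition whose Durfee square has side [c], whose [i]-th row is
    [i + #{x in a | i <= x}] for [1 <= i <= c], and whose rows below the square
    are [b] with one copy of each of [1, ..., c - 1] removed.  Requiring
    [1, ..., c - 1] to occur in [a] says exactly that the counts
    [#{x in a | i <= x}] decrease strictly in [i], that is, that adding [i]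
    leaves the rows nonincreasing. *)
Require Import Defs.
From mathcomp Require Import all_boot zify.

(** * Counting by bijection, and removal from multisets *)

(** Pushed into [Y], both enumerations are duplicate-free with the same elements. The bijection [f]
    thus acts on plain sequences, away from the bounded encodings [i] and [j]. *)
Lemma card_eq_surj (T U : finType) (X Y : eqType) (i : T -> X) (j : U -> Y)
    (P : pred X) (Q : pred Y) (f : X -> Y) :
  injective i -> injective j ->
  (forall x, P x -> exists t, i t = x) -> (forall y, Q y -> exists u, j u = y) ->
  (forall x, P x -> Q (f x)) -> {in P &, injective f} ->
  (forall y, Q y -> exists2 x, P x & f x = y) ->
  #|[set t | P (i t)]| = #|[set u | Q (j u)]|.
Proof.
move=> i_inj j_inj iP jQ fPQ f_inj f_surj; rewrite !cardE.
rewrite -(size_map (fun t => f (i t))) -[RHS](size_map j).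
apply/perm_size/uniq_perm.
- rewrite map_inj_in_uniq ?enum_uniq // => t u.
  rewrite !mem_enum !inE => Pt Pu /(f_inj _ _ Pt Pu); exact: i_inj.
- by rewrite map_inj_uniq ?enum_uniq.
move=> y; apply/mapP/mapP => [[t + ->]|[u + ->]]; rewrite mem_enum inE.
- by move=> /fPQ Qt; have [u ju] := jQ _ Qt; exists u; rewrite // mem_enum inE ju.
- move=> /f_surj[x Px <-]; have [t it] := iP _ Px; exists t; last by rewrite it.
  by rewrite mem_enum inE it.
Qed.

Lemma perm_foldr_rem (T : eqType) (s b : seq T) :
  uniq s -> {subset s <= b} -> perm_eq b (s ++ foldr (fun x => rem x) b s).
Proof.
elim: s => //= x s IHs /andP[xs us] sb.
have {}IHs : perm_eq b (s ++ foldr (fun x => rem x) b s).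
  by apply: IHs => // y ys; apply: sb; rewrite inE ys orbT.
have := sb x (mem_head x s); rewrite (perm_mem IHs) mem_cat (negPf xs) /= => xr.
rewrite (perm_trans IHs) // -cat1s perm_sym perm_catCA perm_cat2l perm_sym.
exact: perm_to_rem.
Qed.

Lemma foldr_rem_subseq (T : eqType) (s b : seq T) :
  subseq (foldr (fun x => rem x) b s) b.
Proof. by elim: s => //= x s; apply: subseq_trans (rem_subseq _ _). Qed.

(** * Order facts, tail counts, conjugates and Durfee squares *)

Lemma geq_trans : transitive geq.
Proof. by move=> y x z /= yx zy; apply: leq_trans yx. Qed.

Lemma geq_anti : antisymmetric geq.
Proof. by move=> x y; rewrite /= andbC => /anti_leq. Qed.

Lemma geq_total : total geq.
Proof. by move=> x y; apply: leq_total. Qed.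

Lemma count_leqS (a : seq nat) k :
  count (leq k) a = count_mem k a + count (leq k.+1) a.
Proof. by elim: a => //= x a ->; case: ltngtP => _; lia. Qed.

Lemma count_leq_eq0 (a : seq nat) c k :
  all (geq c) a -> c < k -> count (leq k) a = 0.
Proof. by elim: a => //= x a IHa /andP[xc /IHa] IH ck; rewrite IH //; lia. Qed.

(** Double counting: a part [x <= c] is counted once for each [i < x]. *)
Lemma sumn_count (a : seq nat) c :
  all (geq c) a -> sumn a = \sum_(i < c) count (leq i.+1) a.
Proof.
elim: a => [_|x a IHa] /=; first by rewrite big1.
case/andP=> xc /IHa->; rewrite big_split /=; congr addn.
elim: c x xc {IHa a} => [|c IHc] x xc; first by rewrite big_ord0; lia.
rewrite big_ord_recr /=; move: xc; rewrite leq_eqVlt => /predU1P[->|xc].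
  rewrite (eq_bigr (fun=> 1)) => [|i _]; last by rewrite ltnS ltnW.
  by rewrite sum1_card card_ord ltnSn addn1.
by rewrite -IHc // leqNgt xc addn0.
Qed.

(** [a] is the partition conjugate to [h]: raise by one the parts obtained for the shifted [h], then
    prepend [h 0 - h 1] ones. *)
Lemma exists_conjugate (h : nat -> nat) c :
    (forall i, h i.+1 <= h i) -> h c = 0 ->
  exists a, [/\ sorted leq a, 0 \notin a & forall i, count (leq i.+1) a = h i].
Proof.
elim: c h => [|c IHc] h h_anti hc.
  exists [::]; split=> // i /=; elim: i => [|i IHi]; first by rewrite hc.
  by have := h_anti i; rewrite -IHi; lia.
have [a [a_sorted a0 ha]] := IHc (fun i => h i.+1) (fun i => h_anti i.+1) hc.
exists (nseq (h 0 - h 1) 1 ++ map succn a); split.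
- rewrite (sorted_pairwise leq_trans) pairwise_cat -!(sorted_pairwise leq_trans).
  apply/and3P; split.
  + by apply/allrelP => x y /nseqP[-> _] /mapP[z _ ->].
  + by elim: (h 0 - h 1) => //= -[].
  + by rewrite sorted_map.
- by rewrite mem_cat mem_nseq andbF; apply/mapP => -[].
- move=> i; rewrite count_cat count_nseq count_map.
  rewrite (eq_count (a2 := leq i)) //; case: i => [|i] /=; last first.
    by rewrite ha.
  rewrite count_leqS (count_memPn a0) ha mul1n.
  exact: subnK.
Qed.

Lemma exists_durfee (s : seq nat) : exists c,
  [/\ c <= size s, nth 0 s c <= c & forall i, i < c -> i < nth 0 s i].
Proof.
(* The default [0] past the end ensures that a least such [c] exists; it is the Durfee side when [s]
   is nonincreasing. *)
have ex : exists c, nth 0 s c <= c by exists (size s); rewrite nth_default.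
exists (ex_minn ex); case: ex_minnP => c sc c_min; split=> //.
  by apply: c_min; rewrite nth_default.
by move=> i ic; rewrite ltnNge; apply: contraL ic => /c_min; rewrite -leqNgt.
Qed.

(** * The map from stacks to partitions *)

Definition square_rows (a : seq nat) (c : nat) : seq nat :=
  mkseq (fun i => i.+1 + count (leq i.+1) a) c.

Definition rows_below (c : nat) (b : seq nat) : seq nat :=
  foldr (fun x => rem x) b (iota 1 c.-1).

Definition stack_partition (x : seq nat * nat * seq nat) : seq nat :=
  square_rows x.1.1 x.1.2 ++ rows_below x.1.2 x.2.

Definition is_stack n (x : seq nat * nat * seq nat) : bool :=
  is_receding_stack n x.1.1 x.1.2 x.2.

Lemma is_receding_stackP n a c b :
  reflect
    [/\ [/\ 0 \notin a, sorted leq a, all (geq c) a &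
           {subset iota 1 c.-1 <= a}],
        [/\ 0 \notin b, sorted geq b, all (geq c) b &
           {subset iota 1 c.-1 <= b}],
        0 < c & sumn a + c + sumn b = n]
    (is_receding_stack n a c b).
Proof.
rewrite /is_receding_stack mem_cat inE !negb_or sumn_cat /= -cats1.
rewrite (sorted_pairwise leq_trans (a ++ _)) (path_sortedE geq_trans).
rewrite pairwise_cat -(sorted_pairwise leq_trans) allrel1r /= andbT addnA.
apply: (iffP idP).
  case/and5P=> /and3P[a0 c0 b0] /eqP sn /andP[ac sa] /andP[bc sb] /andP[/allP ca].
  by move=> /allP cb; split=> //; lia.
case=> -[a0 sa ac ca] [b0 sb bc cb] c0 ->.
rewrite a0 b0 sa sb eqxx eq_sym -lt0n c0 !andbT (eq_all (a2 := geq c)) // ac bc /=.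
by apply/andP; split; apply/allP.
Qed.

Lemma perm_rows_below c b :
  {subset iota 1 c.-1 <= b} -> perm_eq b (iota 1 c.-1 ++ rows_below c b).
Proof. exact/perm_foldr_rem/iota_uniq. Qed.

Lemma mem_rows_below c b : {subset rows_below c b <= b}.
Proof. exact/mem_subseq/foldr_rem_subseq. Qed.

Lemma rows_below_sorted c b : sorted geq b -> sorted geq (rows_below c b).
Proof. exact/(subseq_sorted geq_trans)/foldr_rem_subseq. Qed.

Lemma sumn_iota_square c : 0 < c ->
  sumn (iota 1 c.-1) + c = \sum_(i < c) i.+1.
Proof.
case: c => // c _; rewrite big_ord_recr /= sumnE; congr addn.
by rewrite -(big_mkord predT succn) -[1]addn0 iotaDl big_map /index_iota subn0.
Qed.

(** The staircase [1 + ... + c] added to the rows makes up for the summit and for the copies removed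
    from [b], so total size is preserved. *)
Lemma sumn_square_rows a c : all (geq c) a -> 0 < c ->
  sumn (square_rows a c) = sumn (iota 1 c.-1) + c + sumn a.
Proof.
move=> ac c0; rewrite (sumn_count _ _ ac) sumn_iota_square // -big_split /=.
rewrite sumnE big_map -[iota 0 c]/(iota 0 c) -{1}[c]subn0.
by rewrite -/(index_iota 0 c) big_mkord.
Qed.

Lemma stack_partition_is_partition n x :
  is_stack n x -> is_partition n (stack_partition x).
Proof.
case: x => -[a c] b /is_receding_stackP /= [[a0 sa ac ca] [b0 sb bc cb] c0 sn].
rewrite /is_partition /stack_partition /=; apply/and3P; split.
- rewrite mem_cat negb_or; apply/andP; split; first by apply/mapP => -[].
  by apply: contra b0; apply: mem_rows_below.
- rewrite (sorted_pairwise geq_trans) pairwise_cat -!(sorted_pairwise geq_trans).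
  have sq_sorted : sorted geq (square_rows a c).
    apply/(sortedP 0) => i; rewrite size_mkseq => ic.
    rewrite !nth_mkseq //; last by lia.
    rewrite (count_leqS _ i.+1) /=.
    (* An occurrence of [i.+1] in [a] makes the tail count drop, which absorbs the staircase's step
       up by one. *)
    have: 0 < count_mem i.+1 a by rewrite -has_count has_pred1 ca // mem_iota; lia.
    by move=> a_i; rewrite addnA leq_add2r -[i.+2]addn1 leq_add2l.
  rewrite sq_sorted rows_below_sorted // !andbT.
  apply/allrelP => u v /mapP[i]; rewrite mem_iota => /andP[_ ic] ->.
  move=> /mem_rows_below/(allP bc) /= vc; apply: leq_trans vc _.
  have sqE j : j < c -> nth 0 (square_rows a c) j = j.+1 + count (leq j.+1) a.
    exact: nth_mkseq.
  (* The last row of the square already has length at least [c], which bounds the parts of [b]. *)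
  have : nth 0 (square_rows a c) c.-1 <= nth 0 (square_rows a c) i.
    apply: (sorted_leq_nth geq_trans leqnn) => //;
      by rewrite ?[_ \in _]size_mkseq ?inE /= ?size_mkseq; lia.
  by rewrite !sqE //; lia.
- rewrite sumn_cat sumn_square_rows //.
  by have /perm_sumn := perm_rows_below _ _ cb; rewrite sumn_cat; lia.
Qed.

(** * Injectivity *)

(** These two properties determine [c], so the summit can be read off the image. *)
Lemma durfee_stack_partition n x : is_stack n x ->
  nth 0 (stack_partition x) x.1.2 <= x.1.2 /\
  (forall i, i < x.1.2 -> i < nth 0 (stack_partition x) i).
Proof.
case: x => -[a c] b /is_receding_stackP /= [_ [b0 sb bc cb] c0 sn] /=; split.
  rewrite nth_cat size_mkseq ltnn subnn.
  case E: (rows_below c b) => [|y s] //=.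
  by apply/(allP bc)/(@mem_rows_below c); rewrite E mem_head.
by move=> i ic; rewrite nth_cat size_mkseq ic nth_mkseq // leq_addr.
Qed.

(** Differences of consecutive tail counts are the multiplicities, which determine a sorted
    sequence. *)
Lemma eq_sorted_count (a a' : seq nat) c :
    sorted leq a -> sorted leq a' -> 0 \notin a -> 0 \notin a' ->
    all (geq c) a -> all (geq c) a' ->
    (forall i, i < c -> count (leq i.+1) a = count (leq i.+1) a') ->
  a = a'.
Proof.
move=> sa sa' a0 a'0 ac a'c eq_count.
have eqc i : count (leq i.+1) a = count (leq i.+1) a'.
  by case: (ltnP i c) => [/eq_count//|ci]; rewrite !(count_leq_eq0 _ c).
apply: (sorted_eq leq_trans anti_leq sa sa').
apply/allP => -[|i] _ /=; first by rewrite !(count_memPn _).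
have := eqc i; rewrite (count_leqS a) (count_leqS a') eqc => /addIn ->.
exact: eqxx.
Qed.

Lemma stack_partition_inj n : {in is_stack n &, injective stack_partition}.
Proof.
move=> x y; rewrite !unfold_in => Px Py eq_xy.
have [] := durfee_stack_partition _ _ Py.
have [] := durfee_stack_partition _ _ Px.
rewrite -eq_xy; move: (stack_partition x) => s nx ltx ny lty.
have c_eq : x.1.2 = y.1.2.
  (* If the sides differed, the row indexed by the smaller one would be both at most and above that
     side. *)
  by case: (ltngtP x.1.2 y.1.2) => // [/lty|/ltx]; lia.
case: x y Px Py eq_xy c_eq {nx ltx ny lty} => -[a c] b [[a' c'] b'] /=.
move=> Px + + eq_c; rewrite -{c'}eq_c => Py eq_xy.
have [[a0 sa ac ca] [b0 sb bc cb] c0 _] := is_receding_stackP _ _ _ _ Px.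
have [[a'0 sa' a'c ca'] [b'0 sb' b'c cb'] _ _] := is_receding_stackP _ _ _ _ Py.
move/eqP: eq_xy; rewrite eqseq_cat ?size_mkseq // => /andP[/eqP eq_sq /eqP eq_r].
have -> : a = a'.
  apply: (eq_sorted_count _ _ c) => // i ic.
  by move/(congr1 (fun s => nth 0 s i)): eq_sq; rewrite !nth_mkseq // => /addnI.
have -> // : b = b'.
(* Each of [b] and [b'] is the sorted rearrangement of [1, ..., c - 1] and the common lower rows. *)
apply: (sorted_eq geq_trans geq_anti sb sb').
rewrite /= in eq_r; apply: perm_trans (perm_rows_below _ _ cb) _.
by rewrite eq_r perm_sym perm_rows_below.
Qed.

(** * Surjectivity and conclusion *)

Lemma stack_partition_surj n s : 0 < n -> is_partition n s ->
  exists2 x, is_stack n x & stack_partition x = s.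
Proof.
move=> n0 /and3P[s0 ss /eqP sn].
have [c [c_size sc ltc]] := exists_durfee s.
(* Side [0] would make [s] empty or give it a zero first part. *)
have c0 : 0 < c.
  case: c sc {c_size ltc} => //; case: s s0 sn {ss} => [|x s] /=; first by lia.
  by rewrite inE negb_or leqn0 eq_sym => /andP[/negPf->].
have s_anti i j : i <= j -> j < size s -> nth 0 s j <= nth 0 s i.
  by move=> ij js; apply: (sorted_leq_nth geq_trans leqnn 0 ss);
     rewrite ?inE //; lia.
(* The prescribed tail counts of [a]: row lengths less the staircase. By [ltc] the subtraction never
   truncates. *)
pose h i := if i < c then nth 0 s i - i.+1 else 0.
have h_anti i : h i.+1 <= h i.
  rewrite /h; case: ifP => // ic; rewrite (ltnW ic).
  by have := s_anti i i.+1 (leqnSn i) (leq_trans ic c_size); lia.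
have hc : h c = 0 by rewrite /h ltnn.
have [a [sa a0 ha]] := exists_conjugate h c h_anti hc.
have ac : all (geq c) a.
  have : ~~ has (leq c.+1) a by rewrite has_count ha hc.
  by rewrite -all_predC; apply: sub_all => x /=; lia.
(* Below [c], the rows do not increase while the staircase grows, so [h] drops strictly and each
   multiplicity is positive. *)
have ca : {subset iota 1 c.-1 <= a}.
  case=> [|i]; rewrite mem_iota // => /andP[_ ic].
  rewrite -has_pred1 has_count.
  have := count_leqS a i.+1; rewrite !ha /h.
  have -> : i.+1 < c by lia.
  have -> : i < c by lia.
  have := s_anti i i.+1 (leqnSn i); have := ltc i.+1; lia.
pose b := sort geq (iota 1 c.-1 ++ drop c s).
have pb : perm_eq b (iota 1 c.-1 ++ drop c s) by rewrite perm_sort.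
have sb : sorted geq b by apply/sort_sorted/geq_total.
have cb : {subset iota 1 c.-1 <= b}.
  by move=> i ic; rewrite (perm_mem pb) mem_cat ic.
have eq_rows : rows_below c b = drop c s.
  apply: (sorted_eq geq_trans geq_anti).
  - exact: rows_below_sorted.
  - exact: drop_sorted.
  by rewrite -(perm_cat2l (iota 1 c.-1)) -(permPr pb) perm_sym perm_rows_below.
have eq_sq : square_rows a c = take c s.
  apply: (@eq_from_nth _ 0); rewrite size_mkseq; first by rewrite size_takel.
  move=> i ic; rewrite nth_mkseq // nth_take // ha /h ic.
  by have := ltc i ic; lia.
exists (a, c, b); last by rewrite /stack_partition /= eq_sq eq_rows cat_take_drop.
rewrite /is_stack /=; apply/is_receding_stackP; split=> //; last first.
  move: sn; rewrite -{1}(cat_take_drop c s) -eq_sq sumn_cat sumn_square_rows //.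
  by rewrite (perm_sumn pb) sumn_cat; lia.
split=> //.
  by rewrite (perm_mem pb) mem_cat mem_iota /=; apply: contra s0; apply: mem_drop.
rewrite (perm_all _ pb) all_cat; apply/andP; split.
  by apply/allP => i; rewrite mem_iota /=; lia.
(* Rows of index at least [c] are bounded by row [c], hence by [c] through [sc]. *)
apply/(all_nthP 0) => i; rewrite size_drop nth_drop => ic /=.
by apply: leq_trans (s_anti _ _ (leq_addr i c) _) sc; lia.
Qed.

Lemma num_partitions0 : num_partitions 0 = 1.
Proof.
apply/eqP/cards1P; exists (@Bseq 0 _ [::] isT); apply/setP => s; rewrite !inE.
have -> : s = @Bseq 0 _ [::] isT by apply/val_inj/nilP; case: s => -[].
by rewrite eqxx.
Qed.

Theorem proposition2p1 (n : nat) : num_receding_stacks n = num_partitions n.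
Proof.
(* At [n = 0] the conventional value [1] matches the empty partition. *)
rewrite /num_receding_stacks; case: posnP => [->|n0].
  by rewrite num_partitions0.
pose i (x : bounded_seq n * 'I_n.+1 * bounded_seq n) : seq nat * nat * seq nat :=
  (parts x.1.1, val x.1.2, parts x.2).
apply: (card_eq_surj _ _ _ _ i (@parts n) (is_stack n) (is_partition n)
  stack_partition).
- move=> [[a c] b] [[a' c'] b'] [] /parts_inj-> /val_inj-> /parts_inj->.
  by [].
- exact: parts_inj.
- move=> [[a c] b] /receding_stack_bounded[x [xa xc xb]].
  by exists x; rewrite /i xa xc xb.
- exact: partition_bounded.
- exact: stack_partition_is_partition.
- exact: stack_partition_inj.
- by move=> s; apply: stack_partition_surj.
Qed.
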